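(* The modal logic $\mathsf{S4}$ is complete for finite transitive reflexive provability models with necessitation, local soundness and local completeness: if $A\in\mathcal L_\Box$ holds at every world of every such model, then $\mathsf{S4}\vdash A$.
   Context: $\mathsf{S4}$ is $\mathsf K$ (the smallest normal modal logic) plus $\Box A\to\Box\Box A$ and $\Box A\to A$. Language $\mathcal L_\Box$: formulas built from atomic propositions and $\bot$ using $\to$ and a unary $\Box$. A formula is purely modal if it is a Boolean combination of formulas $\Box B$. A theory is a pair of a set of axioms and a set of inference rules (finitely many premises, one conclusion); $\mathsf T\vdash A$ means derivability from axioms by rules. A theory is classical if modus ponens is one of its rules and all classical tautologies are derivable. A provability pre-model is $\mathcal P=(W,\sqsubset,\{L_w\}_{w\in W^\sqsubset},V)$ with $W$ nonempty, $\sqsubset$ a binary relation on $W$, $V\subseteq W\times\mathrm{atoms}$, $W^\sqsubset=\{u:\exists v\,(v\sqsubset u)\}$, and a theory $L_w$ for each $w\in W^\sqsubset$. Satisfaction: atoms via $V$, $\bot$ never holds, $\to$ classical, $\mathcal P,w\Vdash\Box A$ iff $L_u\vdash A$ for all $u$ with $w\sqsubset u$. With $\sqsubset^+$ the transitive closure, $\mathcal P,w\Vdash^+A$ iff there is $u\sqsubset w$ with $\mathcal P,v\Vdash A$ for all $v$ such that $u\sqsubset^+v$. A provability model is a pre-model in which every $L_w$ is classical and which satisfies modal completeness: for every $w\in W^\sqsubset$ and purely modal $A$, $\mathcal P,w\Vdash^+A$ implies $L_w\vdash A$. Necessitation: every $L_w$ has the rule ''from $A$ infer $\Box A$''. Local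 completeness: for every $w\in W^\sqsubset$ and every formula $A$, $\mathcal P,w\Vdash^+A$ implies $L_w\vdash A$. Local soundness: for every $w\in W^\sqsubset$ and every $A$, $L_w\vdash A$ implies $\mathcal P,w\Vdash A$. *)

(* Defs.v *)
From Stdlib Require Import List Relations FinFun.
Import ListNotations.

Inductive form (Atom : Type) : Type :=
| Var (p : Atom)
| Bot
| Imp (A B : form Atom)
| Box (A : form Atom).

Arguments Var {Atom} p.
Arguments Bot {Atom}.
Arguments Imp {Atom} A B.
Arguments Box {Atom} A.

(* [Bot] is the nullary Boolean connective; with [Imp] it generates all the
   others, e.g. the negation [Imp A Bot]. *)
Inductive purely_modal {Atom : Type} : form Atom -> Prop :=
| purely_modal_Box B : purely_modal (Box B)
| purely_modal_Bot : purely_modal Bot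
| purely_modal_Imp A B :
    purely_modal A -> purely_modal B -> purely_modal (Imp A B).

(* A valuation treats atoms and boxed formulas as propositional variables, so
   that the tautologies are the substitution instances in the modal language
   of the tautologies of classical propositional logic. *)
Fixpoint beval {Atom : Type} (v : form Atom -> bool) (A : form Atom) : bool :=
  match A with
  | Var _ | Box _ => v A
  | Bot => false
  | Imp B C => implb (beval v B) (beval v C)
  end.

Definition tautology {Atom : Type} (A : form Atom) : Prop :=
  forall v : form Atom -> bool, beval v A = true.

(* An inference rule is the set of its instances (premises, conclusion). *)
Definition rule (Atom : Type) : Type := list (form Atom) -> form Atom -> Prop.

Definition modus_ponens {Atom : Type} : rule Atom :=
  fun ps C => exists A : form Atom, ps = [Imp A C; A].

Definition nec_rule {Atom : Type} : rule Atom :=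
  fun ps C => exists A : form Atom, ps = [A] /\ C = Box A.

Record theory (Atom : Type) : Type := Theory {
  axioms : form Atom -> Prop;
  rules : rule Atom -> Prop
}.

Arguments Theory {Atom} axioms rules.
Arguments axioms {Atom} t _.
Arguments rules {Atom} t _.

Inductive derivable {Atom : Type} (T : theory Atom) : form Atom -> Prop :=
| derivable_axiom A : axioms T A -> derivable T A
| derivable_rule r ps C :
    rules T r -> r ps C ->
    (forall B, In B ps -> derivable T B) -> derivable T C.

Definition classical {Atom : Type} (T : theory Atom) : Prop :=
  rules T modus_ponens /\
  (forall A : form Atom, tautology A -> derivable T A).

Inductive K_axiom {Atom : Type} : form Atom -> Prop :=
| K_taut A : tautology A -> K_axiom A
| K_dist A B : K_axiom (Imp (Box (Imp A B)) (Imp (Box A) (Box B))).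

Definition K (Atom : Type) : theory Atom :=
  Theory K_axiom (fun r => r = modus_ponens \/ r = nec_rule).

Inductive S4_axiom {Atom : Type} : form Atom -> Prop :=
| S4_K A : axioms (K Atom) A -> S4_axiom A
| S4_4 A : S4_axiom (Imp (Box A) (Box (Box A)))
| S4_T A : S4_axiom (Imp (Box A) A).

Definition S4 (Atom : Type) : theory Atom := Theory S4_axiom (rules (K Atom)).

(* [th] is total; its values outside [in_range] are junk that nothing below
   depends on. *)
Record premodel (Atom : Type) : Type := Premodel {
  world : Type;
  world_nonempty : inhabited world;
  acc : relation world;
  th : world -> theory Atom;
  val : world -> Atom -> Prop
}.

Arguments world {Atom} p.
Arguments world_nonempty {Atom} p.
Arguments acc {Atom} p _ _.
Arguments th {Atom} p _.
Arguments val {Atom} p _ _.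

(* The set of worlds that have a predecessor. *)
Definition in_range {Atom : Type} (P : premodel Atom) (w : world P) : Prop :=
  exists v : world P, acc P v w.

Fixpoint sat {Atom : Type} (P : premodel Atom) (w : world P) (A : form Atom)
    : Prop :=
  match A with
  | Var p => val P w p
  | Bot => False
  | Imp B C => sat P w B -> sat P w C
  | Box B => forall u : world P, acc P w u -> derivable (th P u) B
  end.

Definition sat_plus {Atom : Type} (P : premodel Atom) (w : world P)
    (A : form Atom) : Prop :=
  exists u : world P, acc P u w /\
    forall v : world P, clos_trans (world P) (acc P) u v -> sat P v A.

Definition modally_complete {Atom : Type} (P : premodel Atom) : Prop :=
  forall w : world P, in_range P w ->
  forall A : form Atom, purely_modal A -> sat_plus P w A -> derivable (th P w) A.

Definition provability_model {Atom : Type} (P : premodel Atom) : Prop :=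
  (forall w : world P, in_range P w -> classical (th P w)) /\
  modally_complete P.

Definition necessitation {Atom : Type} (P : premodel Atom) : Prop :=
  forall w : world P, in_range P w -> rules (th P w) nec_rule.

Definition locally_complete {Atom : Type} (P : premodel Atom) : Prop :=
  forall w : world P, in_range P w ->
  forall A : form Atom, sat_plus P w A -> derivable (th P w) A.

Definition locally_sound {Atom : Type} (P : premodel Atom) : Prop :=
  forall w : world P, in_range P w ->
  forall A : form Atom, derivable (th P w) A -> sat P w A.

(* Main.v *)
(* For a transitive reflexive Kripke model, let [L_w] be the set of formulas
   true throughout the cone above [w]. This set is closed under modus ponens
   and necessitation, so provability satisfaction coincides with Kripke
   satisfaction, and local soundness and completeness are immediate. The theorem
   thus reduces to the finite model property of S4, which is proved by taking
   as worlds the maximal consistent choices between [C] and its negation for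
   [C] ranging over the subformulas of the given formula; [w] sees [u] when
   every box in [w] is in [u]. *)
Require Import Defs.
From Stdlib Require Import List Relations FinFun Classical ClassicalEpsilon ProofIrrelevance Bool.
Import ListNotations.

(** * Derivability in S4 from finitely many hypotheses *)

Definition Neg {Atom : Type} (A : form Atom) : form Atom := Imp A Bot.

(** Hypotheses stay inside the formula as iterated implications: necessitation is then only ever
    applied to theorems, and no deduction theorem is needed. *)
Fixpoint imps {Atom : Type} (g : list (form Atom)) (C : form Atom)
    : form Atom :=
  match g with
  | [] => C
  | B :: g' => Imp B (imps g' C)
  end.

Definition taut_entails {Atom : Type} (g : list (form Atom)) (C : form Atom)
    : Prop :=
  forall v : form Atom -> bool,
    (forall B, In B g -> beval v B = true) -> beval v C = true.

Definition consistent {Atom : Type} (g : list (form Atom)) : Prop :=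
  ~ derivable (S4 Atom) (imps g Bot).

Lemma beval_imps {Atom : Type} (v : form Atom -> bool) g C :
  beval v (imps g C) = true <->
  ((forall B, In B g -> beval v B = true) -> beval v C = true).
Proof.
  induction g as [|B g IH]; simpl; [firstorder|].
  destruct (beval v B) eqn:E; simpl.
  - rewrite IH; split; intros H HB; apply H; auto.
    intros D [<- | HD]; auto.
  - split; auto. intros _ HB. specialize (HB B (or_introl eq_refl)). congruence.
Qed.

Section S4Derivations.
Variable Atom : Type.
Implicit Types (B C D : form Atom) (g h : list (form Atom)).

Local Notation "|- C" := (derivable (S4 Atom) C) (at level 75).

Lemma S4_mp B C : |- Imp B C -> |- B -> |- C.
Proof.
  intros HBC HB. apply derivable_rule with (r := modus_ponens) (ps := [Imp B C; B]).
  - now left.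
  - now exists B.
  - intros D [<- | [<- | []]]; assumption.
Qed.

Lemma S4_nec B : |- B -> |- Box B.
Proof.
  intros HB. apply derivable_rule with (r := nec_rule) (ps := [B]).
  - now right.
  - now exists B.
  - intros D [<- | []]; assumption.
Qed.

Lemma S4_taut B : tautology B -> |- B.
Proof. intros H. apply derivable_axiom. apply S4_K. now apply K_taut. Qed.

Lemma S4_imps_mp g C : (forall B, In B g -> |- B) -> |- imps g C -> |- C.
Proof.
  induction g as [|B g IH]; simpl; intros Hg HC; [exact HC|].
  apply IH; [now auto|]. apply S4_mp with B; auto.
Qed.

Lemma S4_taut_entails g C :
  (forall B, In B g -> |- B) -> taut_entails g C -> |- C.
Proof.
  intros Hg H. apply (S4_imps_mp g); [exact Hg|].
  apply S4_taut. intros v. apply beval_imps, H.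
Qed.

(** Purely propositional: the conclusion is a tautological consequence of [imps h C] together with
    the formulas [imps g B], for [B] in [h]. *)
Lemma imps_cut g h C :
  (forall B, In B h -> |- imps g B) -> |- imps h C -> |- imps g C.
Proof.
  intros Hh HC. apply (S4_taut_entails (imps h C :: map (imps g) h)).
  - intros B [<- | HB]; [exact HC|].
    apply in_map_iff in HB as [D [<- HD]]. auto.
  - intros v Hv. apply beval_imps. intros Hg.
    apply (proj1 (beval_imps v h C)); [apply Hv; now left|].
    intros B HB. apply (proj1 (beval_imps v g B)); [|exact Hg].
    apply Hv. right. now apply in_map.
Qed.

Lemma imps_taut g C : taut_entails g C -> |- imps g C.
Proof. intros H. apply S4_taut. intros v. apply beval_imps, H. Qed.

Lemma imps_hyp g C : In C g -> |- imps g C.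
Proof. intros H. apply imps_taut. intros v Hv. auto. Qed.

Lemma imps_apply g B C : |- Imp B C -> |- imps g B -> |- imps g C.
Proof.
  intros HBC HB. apply imps_cut with [B]; [|exact HBC].
  intros D [<- | []]; exact HB.
Qed.

Lemma imps_Neg g C : |- imps (Neg C :: g) Bot -> |- imps g C.
Proof.
  intros H. apply (S4_taut_entails [imps (Neg C :: g) Bot]).
  - intros B [<- | []]; exact H.
  - intros v Hv. apply beval_imps. intros Hg.
    specialize (Hv _ (or_introl eq_refl)).
    destruct (beval v C) eqn:E; [reflexivity|exfalso].
    enough (beval v Bot = true) by discriminate.
    apply (proj1 (beval_imps v (Neg C :: g) Bot) Hv).
    intros B [<- | HB]; [simpl; now rewrite E | auto].
Qed.

Lemma consistent_incl g h : incl g h -> consistent h -> consistent g.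
Proof.
  intros Hgh Hh Hg. apply Hh. apply imps_cut with g; [|exact Hg].
  intros B HB. apply imps_hyp, Hgh, HB.
Qed.

Lemma consistent_not_Neg g C : consistent g -> |- imps g C -> ~ In (Neg C) g.
Proof.
  intros Hg HC HN. apply Hg. apply imps_cut with [C; Neg C].
  - intros B [<- | [<- | []]]; [exact HC | now apply imps_hyp].
  - apply imps_taut. intros v Hv.
    pose proof (Hv C (or_introl eq_refl)) as H1.
    pose proof (Hv (Neg C) (or_intror (or_introl eq_refl))) as H2.
    simpl in H2. now rewrite H1 in H2.
Qed.

Lemma consistent_case g C :
  consistent g -> consistent (C :: g) \/ consistent (Neg C :: g).
Proof.
  intros Hg. apply NNPP. intros H. apply not_or_and in H as [H1 H2].
  apply NNPP in H1, H2. apply Hg. apply imps_cut with (C :: g); [|exact H1].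
  intros B [<- | HB]; [now apply imps_Neg | now apply imps_hyp].
Qed.

Lemma imps_Box g C : |- imps g C -> |- imps (map Box g) (Box C).
Proof.
  (* The K axiom is pushed along the list, one antecedent at a time. *)
  assert (K_imps : |- Imp (Box (imps g C)) (imps (map Box g) (Box C))).
  { induction g as [|B g IH]; simpl.
    - apply S4_taut. intros v. simpl. apply implb_same.
    - apply (S4_taut_entails
        [Imp (Box (Imp B (imps g C))) (Imp (Box B) (Box (imps g C)));
         Imp (Box (imps g C)) (imps (map Box g) (Box C))]).
      + intros D [<- | [<- | []]]; [|exact IH].
        apply derivable_axiom, S4_K, K_dist.
      + intros v Hv.
        pose proof (Hv _ (or_introl eq_refl)) as H1.
        pose proof (Hv _ (or_intror (or_introl eq_refl))) as H2.
        revert H1 H2. simpl.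
        destruct (v (Box (Imp B (imps g C)))), (v (Box B)), (v (Box (imps g C)));
          simpl; auto; discriminate. }
  intros H. apply (S4_mp _ _ K_imps). now apply S4_nec.
Qed.

Definition is_box C : bool := match C with Box _ => true | _ => false end.

(** Axiom 4 enters here: each [Box D] in [g] yields [Box (Box D)], so the boxes of [g], once boxed
    by [imps_Box], still follow from [g]. *)
Lemma imps_boxes g C :
  |- imps (filter is_box g) C -> |- imps g (Box C).
Proof.
  intros H. apply imps_cut with (map Box (filter is_box g)).
  - intros B HB. apply in_map_iff in HB as [D [<- HD]].
    apply filter_In in HD as [HD Hbox]. destruct D as [| | |D]; try discriminate.
    apply imps_apply with (Box D); [apply derivable_axiom, S4_4|].
    now apply imps_hyp.
  - now apply imps_Box.
Qed.

(** * Maximal consistent choices over a finite set of formulas *)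

Fixpoint choices (l : list (form Atom)) : list (list (form Atom)) :=
  match l with
  | [] => [[]]
  | C :: l' => map (cons C) (choices l') ++ map (cons (Neg C)) (choices l')
  end.

Lemma choices_total l g C :
  In g (choices l) -> In C l -> In C g \/ In (Neg C) g.
Proof.
  revert g. induction l as [|D l IH]; simpl; [tauto|].
  intros g Hg HC. apply in_app_or in Hg as [Hg | Hg];
    apply in_map_iff in Hg as [g' [<- Hg']];
    (destruct HC as [-> | HC]; [simpl; tauto|]);
    destruct (IH g' Hg' HC); simpl; tauto.
Qed.

(** A box can only be a positive choice, since [Neg] produces an implication. *)
Lemma choices_Box l g B : In g (choices l) -> In (Box B) g -> In (Box B) l.
Proof.
  revert g. induction l as [|D l IH]; simpl.
  - intros g [<- | []] [].
  - intros g Hg HB. apply in_app_or in Hg as [Hg | Hg];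
      apply in_map_iff in Hg as [g' [<- Hg']]; destruct HB as [HB | HB]; eauto.
    discriminate.
Qed.

(** The formulas of [l] are decided one by one, each choice joining the hypotheses. Joint
    consistency of [g ++ h] is recorded because it forbids [h] to contradict [g]. *)
Lemma lindenbaum l g :
  consistent g -> exists h, In h (choices l) /\ consistent (g ++ h).
Proof.
  revert g. induction l as [|C l IH]; intros g Hg.
  - exists []. rewrite app_nil_r. simpl; auto.
  - assert (step : forall D, consistent (D :: g) ->
        exists h, In h (choices l) /\ consistent (g ++ D :: h)).
    { intros D HD. destruct (IH _ HD) as [h [Hh Hcons]]. exists h. split; auto.
      apply consistent_incl with (2 := Hcons). intros B HB.
      apply in_app_or in HB as [HB | [HB | HB]]; simpl; auto;
        right; apply in_or_app; auto. }
    destruct (consistent_case g C Hg) as [H | H];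
      destruct (step _ H) as [h [Hh Hcons]]; eexists; (split; [|exact Hcons]);
      simpl; apply in_or_app; [left | right]; now apply in_map.
Qed.

Lemma choices_closed l g C :
  In g (choices l) -> consistent g -> In C l -> |- imps g C -> In C g.
Proof.
  intros Hg Hcons HC H. destruct (choices_total l g C Hg HC) as [|HN]; [assumption|].
  now destruct (consistent_not_Neg g C Hcons H).
Qed.

End S4Derivations.

Fixpoint subs {Atom : Type} (A : form Atom) : list (form Atom) :=
  A :: match A with
       | Imp B C => subs B ++ subs C
       | Box B => subs B
       | _ => []
       end.

Lemma subs_refl {Atom : Type} (A : form Atom) : In A (subs A).
Proof. destruct A; now left. Qed.

(** * Finite Kripke completeness of S4 *)

Fixpoint ksat {Atom W : Type} (R : relation W) (V : W -> Atom -> Prop) (w : W)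
    (A : form Atom) : Prop :=
  match A with
  | Var p => V w p
  | Bot => False
  | Imp B C => ksat R V w B -> ksat R V w C
  | Box B => forall u, R w u -> ksat R V u B
  end.

(** The elements of [l] satisfying [Q] are selected classically; by proof irrelevance the choice of
    membership proofs does not matter. *)
Lemma Finite_sig (T : Type) (Q : T -> Prop) (l : list T) :
  (forall x, Q x -> In x l) -> Finite {x | Q x}.
Proof.
  intros Hl.
  assert (H : exists l' : list {x | Q x}, forall s, In (proj1_sig s) l -> In s l').
  { clear Hl. induction l as [|x l [l' IH]].
    - exists []. intros s [].
    - destruct (classic (Q x)) as [q | nq].
      + exists (exist Q x q :: l'). intros [y qy] [Hy | Hy]; simpl in Hy.
        * left. now apply subset_eq_compat.
        * right. now apply IH.
      + exists l'. intros [y qy] [Hy | Hy]; simpl in Hy; [congruence | now apply IH]. }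
  destruct H as [l' H]. exists l'. intros [x q]. apply H. simpl. auto.
Qed.

Section CanonicalModel.
Variables (Atom : Type) (l : list (form Atom)).

Definition can_world : Type := {g | In g (choices Atom l) /\ consistent g}.

(** Inclusion of boxes is a preorder by its very form; axioms T and 4 are spent on the truth lemma
    instead. *)
Definition can_acc : relation can_world := fun w u =>
  forall B : form Atom, In (Box B) (proj1_sig w) -> In (Box B) (proj1_sig u).

Definition can_val (w : can_world) (p : Atom) : Prop := In (Var p) (proj1_sig w).

Lemma can_acc_witness (w : can_world) (B : form Atom) :
  ~ derivable (S4 Atom) (imps (proj1_sig w) (Box B)) ->
  exists u : can_world, can_acc w u /\ ~ In B (proj1_sig u).
Proof.
  destruct w as [g [Hg Hcons]]; simpl. intros HB.
  (* If this seed were inconsistent, the boxes of [g] would imply [B], and so [g] would imply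
     [Box B]. *)
  assert (H0 : consistent (Neg B :: filter (is_box Atom) g)).
  { intros H. apply HB, imps_boxes, imps_Neg, H. }
  destruct (lindenbaum _ l _ H0) as [h [Hh Hgh]].
  assert (Hcons' : consistent h).
  { apply consistent_incl with (2 := Hgh). apply incl_appr, incl_refl. }
  exists (exist _ h (conj Hh Hcons')). split.
  - intros C HC; simpl in *.
    (* [Box C] lies in [l], so [h] decides it; choosing its negation would clash with the seed. *)
    destruct (choices_total _ l h (Box C) Hh) as [|HN]; [|assumption|].
    { now apply choices_Box with g. }
    exfalso. refine (consistent_not_Neg _ _ (Box C) Hgh _ _).
    + apply imps_hyp. right. apply in_or_app. left. now apply filter_In.
    + right. apply in_or_app. now right.
  - simpl. intros HBh. refine (consistent_not_Neg _ _ B Hgh _ _).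
    + apply imps_hyp. right. apply in_or_app. now right.
    + now left.
Qed.

Lemma truth_lemma (C : form Atom) : incl (subs C) l ->
  forall w : can_world, ksat can_acc can_val w C <-> In C (proj1_sig w).
Proof.
  induction C as [p | | B IHB C IHC | B IHB]; intros Hl w;
    pose proof (Hl _ (subs_refl _)) as HC;
    pose proof (proj2_sig w) as [Hg Hcons]; simpl in *.
  - reflexivity.
  - split; [tauto|]. intros H. apply Hcons. now apply imps_hyp.
  - assert (HlB : incl (subs B) l).
    { intros D HD. apply Hl. right. apply in_or_app. now left. }
    assert (HlC : incl (subs C) l).
    { intros D HD. apply Hl. right. apply in_or_app. now right. }
    rewrite (IHB HlB w), (IHC HlC w). split.
    + intros H. apply choices_closed with l; auto.
      (* If [B] is chosen, [H] puts [C] in the world; otherwise [Neg B] already implies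
         [Imp B C]. *)
      destruct (choices_total _ l _ B Hg (HlB _ (subs_refl B))) as [HB | HB].
      * apply imps_apply with C; [|now apply imps_hyp, H].
        apply S4_taut. intros v. simpl.
        now destruct (beval v B), (beval v C).
      * apply imps_apply with (Neg B); [|now apply imps_hyp].
        apply S4_taut. intros v. simpl.
        now destruct (beval v B), (beval v C).
    + intros HBC HB. apply choices_closed with l; auto.
      { apply HlC, subs_refl. }
      apply imps_cut with [Imp B C; B].
      * intros D [<- | [<- | []]]; now apply imps_hyp.
      * apply S4_taut. intros v. simpl.
        now destruct (beval v B), (beval v C).
  - assert (HlB : incl (subs B) l).
    { intros D HD. apply Hl. now right. }
    split.
    + intros H. apply choices_closed with l; auto. apply NNPP. intros HN.
      destruct (can_acc_witness w B HN) as [u [Hu HBu]].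
      apply HBu, IHB, H, Hu. exact HlB.
    + intros H u Hu. apply IHB; [exact HlB|].
      pose proof (proj2_sig u) as [Hgu Hcu]; simpl in *.
      apply choices_closed with l; auto. { apply HlB, subs_refl. }
      (* Accessibility only transports [Box B] to [u]; axiom T then extracts [B]. *)
      apply imps_apply with (Box B); [apply derivable_axiom, S4_T|].
      apply imps_hyp, Hu, H.
Qed.

End CanonicalModel.

Lemma S4_finite_kripke_complete (Atom : Type) (A : form Atom) :
  (forall (W : Type) (R : relation W) (V : W -> Atom -> Prop),
     Finite W -> transitive W R -> reflexive W R ->
     forall w, ksat R V w A) ->
  derivable (S4 Atom) A.
Proof.
  intros H. apply NNPP. intros HA.
  assert (H0 : consistent [Neg A]).
  { intros HN. apply HA. now apply (imps_Neg Atom [] A). }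
  destruct (lindenbaum _ (subs A) _ H0) as [g [Hg Hcons]].
  assert (Hcons' : consistent g).
  { apply consistent_incl with (2 := Hcons). apply incl_appr, incl_refl. }
  set (w := exist _ g (conj Hg Hcons') : can_world Atom (subs A)).
  refine (consistent_not_Neg _ _ A Hcons _ _); [|now left].
  apply imps_hyp. right. simpl.
  apply (truth_lemma Atom (subs A) A (incl_refl _) w). apply H.
  - apply Finite_sig with (choices Atom (subs A)). tauto.
  - intros x y z Hxy Hyz B HB. auto.
  - intros x B HB. exact HB.
Qed.

(** * Provability models from Kripke models *)

Section ConeModel.
Variables (Atom W : Type) (R : relation W) (V : W -> Atom -> Prop) (w0 : W).
Hypotheses (R_trans : transitive W R) (R_refl : reflexive W R).

(** All truths of the cone are taken as axioms, so the two rules required of the theory only have to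
    preserve them. *)
Definition cone_theory (w : W) : theory Atom :=
  Theory (fun A => forall v, R w v -> ksat R V v A)
         (fun r => r = modus_ponens \/ r = nec_rule).

Definition cone_model : premodel Atom :=
  Premodel Atom W (inhabits w0) R cone_theory V.

Lemma derivable_cone_theory (w : W) (A : form Atom) :
  derivable (cone_theory w) A <-> forall v, R w v -> ksat R V v A.
Proof.
  split; [|exact (derivable_axiom (cone_theory w) A)].
  induction 1 as [A HA | r ps C Hr HC _ IH]; [exact HA|].
  intros v Hv. destruct Hr as [-> | ->].
  - destruct HC as [B ->].
    apply (IH (Imp B C) (or_introl eq_refl) v Hv).
    apply (IH B (or_intror (or_introl eq_refl)) v Hv).
  (* By transitivity the successors of [v] lie in the cone above [w]. *)
  - destruct HC as [B [-> ->]]. intros u Hu.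
    apply (IH B (or_introl eq_refl)). now apply R_trans with v.
Qed.

(** In the box case, reflexivity places [u] in its own cone, and transitivity places that cone among
    the successors of [w]. *)
Lemma sat_cone_model (A : form Atom) (w : W) :
  sat cone_model w A <-> ksat R V w A.
Proof.
  revert w. induction A as [p | | B IHB C IHC | B IHB]; intros w; simpl.
  - reflexivity.
  - reflexivity.
  - now rewrite IHB, IHC.
  - split; intros H u Hu.
    + apply (proj1 (derivable_cone_theory u B) (H u Hu)), R_refl.
    + apply derivable_cone_theory. intros v Hv. apply H. now apply R_trans with u.
Qed.

(** Truth at [w], made Boolean by excluded middle, is a valuation of atoms and boxes, and [beval]
    extends it exactly as [ksat] does. *)
Lemma ksat_tautology (A : form Atom) (w : W) : tautology A -> ksat R V w A.
Proof.
  intros HA.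
  assert (Hv : exists v : form Atom -> bool,
      forall B, v B = true <-> ksat R V w B).
  { exists (fun B => if excluded_middle_informative (ksat R V w B)
                     then true else false).
    intros B. now destruct (excluded_middle_informative (ksat R V w B)). }
  destruct Hv as [v Hv].
  enough (E : forall B, beval v B = true <-> ksat R V w B) by (apply E, HA).
  induction B as [p | | B IHB C IHC | B IHB]; simpl.
  - apply Hv.
  - split; [discriminate | tauto].
  - rewrite <- IHB, <- IHC. destruct (beval v B), (beval v C); simpl; intuition.
  - apply Hv.
Qed.

Lemma cone_model_locally_complete : locally_complete cone_model.
Proof.
  intros w _ A [u [Huw HA]]. apply derivable_cone_theory. intros v Hv.
  (* Every [v] in the cone above [w] is a successor of the predecessor [u] of [w], where [A] holds
     by assumption. *)
  apply sat_cone_model, HA, t_step. simpl. now apply R_trans with w.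
Qed.

Lemma cone_model_locally_sound : locally_sound cone_model.
Proof.
  intros w _ A HA. apply sat_cone_model.
  apply (proj1 (derivable_cone_theory w A) HA), R_refl.
Qed.

Lemma cone_model_provability_model : provability_model cone_model.
Proof.
  split.
  - intros w _. split; [now left|]. intros A HA.
    apply derivable_cone_theory. intros v _. now apply ksat_tautology.
  - intros w Hw A _. now apply cone_model_locally_complete.
Qed.

End ConeModel.

Theorem theorem3p12 (Atom : Type) (A : form Atom)
    (hA : forall P : premodel Atom,
        provability_model P ->
        Finite (world P) ->
        transitive (world P) (acc P) ->
        reflexive (world P) (acc P) ->
        necessitation P ->
        locally_sound P ->
        locally_complete P ->
        forall w : world P, sat P w A) :
  derivable (S4 Atom) A.
Proof.
  apply S4_finite_kripke_complete. intros W R V Hfin Htrans Hrefl w.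
  apply (sat_cone_model Atom W R V w Htrans Hrefl).
  apply (hA (cone_model Atom W R V w)); auto.
  - now apply cone_model_provability_model.
  - intros u _. now right.
  - now apply cone_model_locally_sound.
  - now apply cone_model_locally_complete.
Qed.
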